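(* Let $k$ be a field of characteristic different from $2$ and $3$ containing a primitive third root of unity. Let $K := k(s_3,s_4)$ be the field of rational functions in two independent variables $s_3,s_4$ over $k$, and let $S\subset\mathbb{P}^3_K$ be the diagonal cubic surface with equation $$(s_3-s_4)s_3s_4(x_1^3-x_4^3) - (s_3-1)s_3(x_2^3-x_4^3) + (s_4-1)s_4(x_3^3-x_4^3) = 0.$$ Then $S$ is not $K$-rational.
   Context: A surface over $K$ is called $K$-rational if it is birational to $\mathbb{P}^2_K$ over $K$. *)

(* Defs.v *)
From HB Require Import structures.
From mathcomp Require Import all_boot all_order all_algebra.
From mathcomp Require Import fraction.
From mathcomp.multinomials Require Import mpoly.

Set Implicit Arguments.
Unset Strict Implicit.
Unset Printing Implicit Defensive.

Import GRing.Theory.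
Local Open Scope ring_scope.

(* A projective variety X in P^n_K is given by a list of homogeneous equations
   in K[x_0, ..., x_n].  All notions below read "vanishes on X" as "lies in the
   ideal generated by the equations", so they are meant for lists of equations
   that generate a (homogeneous) prime ideal, i.e. for X integral. *)
Section ProjectiveVarieties.

Variable K : fieldType.

Definition equations (n : nat) := seq {mpoly K[n.+1]}.

Definition in_ideal n (X : equations n) (p : {mpoly K[n.+1]}) : Prop :=
  exists c : 'I_(size X) -> {mpoly K[n.+1]}, p = \sum_i c i * X`_i.

Definition proj_space (n : nat) : equations n := [::].

(* Representatives (f_0 : ... : f_n) of rational maps X --> Y, for X in P^m and
   Y in P^n: forms of the same degree, not all vanishing on X.  Note that the
   zero polynomial belongs to d.-homog for every d. *)
Definition rational_map m n (X : equations m) (Y : equations n)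
    (f : n.+1.-tuple {mpoly K[m.+1]}) : Prop :=
  [/\ exists d : nat, forall i, tnth f i \is d.-homog,
      exists i, ~ in_ideal X (tnth f i)
    & forall h, h \in Y -> in_ideal X (h \mPo f)].

(* The image of f is dense in Y: a form that vanishes on it vanishes on Y. *)
Definition dominant m n (X : equations m) (Y : equations n)
    (f : n.+1.-tuple {mpoly K[m.+1]}) : Prop :=
  forall (d : nat) (h : {mpoly K[n.+1]}),
    h \is d.-homog -> in_ideal X (h \mPo f) -> in_ideal Y h.

(* (f_0 : ... : f_n) = (g_0 : ... : g_n) on a dense open subset of X. *)
Definition same_map m n (X : equations m)
    (f g : n.+1.-tuple {mpoly K[m.+1]}) : Prop :=
  forall i j, in_ideal X (tnth f i * tnth g j - tnth f j * tnth g i).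

Definition id_map n : n.+1.-tuple {mpoly K[n.+1]} := [tuple 'X_i | i < n.+1].

Definition comp_map l m n (g : n.+1.-tuple {mpoly K[m.+1]})
    (f : m.+1.-tuple {mpoly K[l.+1]}) : n.+1.-tuple {mpoly K[l.+1]} :=
  [tuple tnth g i \mPo f | i < n.+1].

(* Isomorphism in the category of varieties over K and dominant rational maps;
   dominance makes the composites below well-defined rational maps. *)
Definition birational m n (X : equations m) (Y : equations n) : Prop :=
  exists (f : n.+1.-tuple {mpoly K[m.+1]}) (g : m.+1.-tuple {mpoly K[n.+1]}),
    [/\ rational_map X Y f /\ dominant X Y f,
        rational_map Y X g /\ dominant Y X g,
        same_map X (comp_map g f) (id_map m)
      & same_map Y (comp_map f g) (id_map n)].

Definition rational_surface n (X : equations n) : Prop :=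
  birational X (proj_space 2).

End ProjectiveVarieties.

Section CubicSurface.

Variable k : fieldType.

(* The field k(s_3, s_4). *)
Definition Kfield : fieldType := {fraction {mpoly k[2]}}.

Definition s3 : Kfield := tofrac 'X_(inord 0).
Definition s4 : Kfield := tofrac 'X_(inord 1).

Definition x1 : {mpoly Kfield[4]} := 'X_(inord 0).
Definition x2 : {mpoly Kfield[4]} := 'X_(inord 1).
Definition x3 : {mpoly Kfield[4]} := 'X_(inord 2).
Definition x4 : {mpoly Kfield[4]} := 'X_(inord 3).

(* The coefficient of x4^3 is -(s3 - s4)(s3 - 1)(s4 - 1), so the four
   coefficients are nonzero; when 3 is invertible in k the surface is smooth,
   and the cubic form is irreducible. *)
Definition cubic_form : {mpoly Kfield[4]} :=
  ((s3 - s4) * s3 * s4) *: (x1 ^+ 3 - x4 ^+ 3)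
  - ((s3 - 1) * s3) *: (x2 ^+ 3 - x4 ^+ 3)
  + ((s4 - 1) * s4) *: (x3 ^+ 3 - x4 ^+ 3).

Definition cubic_surface : equations Kfield 3 := [:: cubic_form].

End CubicSurface.

(* Main.v *)
(* Put e = (s3 - 1) / s4 and W = (s3 - s4) e, so that K = k(e, W), and extend
   scalars to k(theta, w) with theta^3 = e and w^3 = W.  With z = x3 and
   t = w x4 the surface becomes
     z^3 - t^3 = rho N(x2 - v x1),   rho = e^2 (w^3 - 1) / (w^3 - e^2),
   where v = w theta / e, N x = x . tau x . tau^2 x and tau is the automorphism
   theta |-> omega theta fixing w.
   Suppose that the surface is rational and let P be its generic point, viewed in
   the plane.  The line joining P to the image of P under z |-> omega z is sent to
   a rational curve on the surface, parametrized by polynomials in one variable r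
   over L = k(theta, w)(P^2).  Along it (z - omega t) / (z - t) is a constant times
   a norm: an irreducible polynomial of L[r] invariant under tau occurs in it with
   multiplicity divisible by 3, because the product of the three factors
   z - omega^i t is rho times a norm and at most one of them has a multiplicity
   exceeding the minimum.  Comparing the values at the two ends of the line makes
   rho a norm from L, hence from k(theta, w).  But rho has valuation 1 at w = 1,
   where norms have valuation divisible by 3. *)

From HB Require Import structures.
From mathcomp Require Import all_boot all_order all_algebra.
From mathcomp Require Import fraction ring zify.
From mathcomp.multinomials Require Import mpoly.
From Stdlib Require Import Classical.
Require Import Defs.

Set Implicit Arguments.
Unset Strict Implicit.
Unset Printing Implicit Defensive.

Import Order.TTheory GRing.Theory.
Local Open Scope ring_scope.

(** * Multiplicities of irreducible polynomials and norms *)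

Section PrimeValuation.

Variable F : fieldType.
Implicit Types P Q h : {poly F}.

Lemma irredp_dvd_exists h : (1 < size h)%N ->
  exists2 P, irreducible_poly P & P %| h.
Proof.
have [n] := ubnP (size h); elim: n h => // n IHn h le_h gt1_h.
(* Irreducibility is not decidable over an arbitrary field, hence the classical case split. *)
have [irr|red] := classic (irreducible_poly h); first by exists h.
have [q /and3P[q1 qh nqh]] :
    exists q : {poly F}, [&& size q != 1, q %| h & ~~ (q %= h)].
  apply: NNPP => nex; apply: red; split=> // q q1 qh.
  by apply/negPn/negP => nqh; apply: nex; exists q; apply/and3P.
have h0 : h != 0 by rewrite -size_poly_gt0 ltnW.
have q0 : q != 0 by apply: contraTneq qh => ->; rewrite dvd0p.
have gt1_q : (1 < size q)%N by rewrite ltn_neqAle eq_sym q1 size_poly_gt0.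
have lt_qh : (size q < size h)%N.
  by rewrite ltn_neqAle dvdp_leq // dvdp_size_eqp // nqh.
have [|P irrP Pq] := IHn q _ gt1_q; first exact: leq_trans lt_qh _.
by exists P => //; apply: dvdp_trans qh.
Qed.

(** The [P]-adic valuation. For nonconstant [P] and nonzero [h], no exponent beyond [size h] can
    divide, so a bounded search finds the true maximum. *)
Definition multp P h :=
  [arg max_(n > (ord0 : 'I_(size h).+1) | P ^+ n %| h) n] : nat.

Lemma irredp_coprimep P h : irreducible_poly P -> coprimep P h = ~~ (P %| h).
Proof.
move=> irrP; apply/idP/idP => [cop|nPh].
  apply/negP => Ph; have := irrP.1.
  by have /coprimepP/(_ P (dvdpp P) Ph) := cop; rewrite -size_poly_eq1 => /eqP->.
rewrite coprimep_def; apply: contraNT nPh => gcd1.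
by rewrite -(eqp_dvdl _ (irrP _ gcd1 (dvdp_gcdl _ _))) dvdp_gcdr.
Qed.

Lemma irredp_eqp P Q : irreducible_poly P -> irreducible_poly Q ->
  P %| Q -> P %= Q.
Proof. by move=> irrP irrQ /irrQ; apply; have := irrP.1; case: (size P) => [|[]]. Qed.

Section Irreducible.
Variable P : {poly F}.
Hypothesis irrP : irreducible_poly P.

Lemma multp_geq h n : h != 0 -> (n <= multp P h)%N = (P ^+ n %| h).
Proof.
move=> h0; rewrite /multp; symmetry.
case: arg_maxnP; rewrite ?expr0 ?dvd1p //= => i i_dvd gti.
case: ltnP => [lt_in|/dvdp_exp2l/dvdp_trans]; last exact.
apply: contraTF (lt_in) => dvd_n; rewrite -leqNgt.
have lt_n : (n < (size h).+1)%N.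
  apply: leq_trans (dvdp_leq h0 dvd_n).
  apply: (@leq_trans (size (P ^+ n)).-1); last exact: leq_pred.
  rewrite size_exp -{1}[n]mul1n leq_mul //.
  by have := irrP.1; case: (size P) => [|[]].
exact: (gti (Ordinal lt_n)).
Qed.

Lemma dvdp_multp h : h != 0 -> P ^+ (multp P h) %| h.
Proof. by move=> h0; rewrite -multp_geq. Qed.

Lemma multp_eq h n q : ~~ (P %| q) -> multp P (P ^+ n * q) = n.
Proof.
move=> nPq; have P0 := irredp_neq0 irrP.
have q0 : q != 0 by apply: contraNneq nPq => ->; rewrite dvdp0.
have h0 : P ^+ n * q != 0 by rewrite mulf_neq0 ?expf_neq0.
apply/eqP; rewrite eqn_leq multp_geq // dvdp_mulIl andbT leqNgt multp_geq //.
by rewrite exprSr dvdp_mul2l ?expf_neq0.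
Qed.

Lemma multpM h1 h2 : h1 != 0 -> h2 != 0 ->
  multp P (h1 * h2) = (multp P h1 + multp P h2)%N.
Proof.
have P0 := irredp_neq0 irrP.
have split h : h != 0 -> exists2 q, h = P ^+ (multp P h) * q & ~~ (P %| q).
  move=> h0; have /dvdpP[q Dh] := dvdp_multp h0.
  exists q; rewrite 1?mulrC //; apply/negP => Pq.
  have : P ^+ (multp P h).+1 %| h.
    by rewrite [h in _ %| h]Dh exprS dvdp_mul2r ?expf_neq0.
  by rewrite -multp_geq // ltnn.
move=> /split[q1 D1 n1] /split[q2 D2 n2].
rewrite [in LHS]D1 [in LHS]D2 mulrACA -exprD multp_eq // -irredp_coprimep //.
by rewrite coprimepMr !irredp_coprimep // n1.
Qed.

Lemma multp_size1 h : size h = 1%N -> multp P h = 0%N.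
Proof.
move=> h1; have h0 : h != 0 by rewrite -size_poly_gt0 h1.
apply/eqP; rewrite -leqn0 leqNgt multp_geq // expr1.
by apply/negP => /(dvdp_leq h0); rewrite h1 leqNgt irrP.1.
Qed.

(** Ultrametric inequality for a linear relation with nonzero constant coefficients. Applied to its
    three rotations, it shows that the least of the three multiplicities is attained at least
    twice. *)
Lemma multp_min (a b c : {poly F}) (u v w : F) : u != 0 -> v != 0 -> w != 0 ->
  u *: a + v *: b + w *: c = 0 -> a != 0 -> b != 0 -> c != 0 ->
  (minn (multp P b) (multp P c) <= multp P a)%N.
Proof.
move=> u0 v0 w0 abc a0 b0 c0; rewrite multp_geq // -(dvdpZr _ _ u0).
have -> : u *: a = - (v *: b + w *: c).
  by apply/eqP; rewrite -subr_eq0 opprK addrA abc.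
by rewrite dvdpNr dvdp_add // dvdpZr // -multp_geq // ?geq_minl ?geq_minr.
Qed.

End Irreducible.

End PrimeValuation.

(** * Norms for an automorphism of order 3 *)

Section Norm.
Variables (R : comNzRingType) (tau : {rmorphism R -> R}).

Definition norm3 (x : R) := x * tau x * tau (tau x).

Lemma norm3M x y : norm3 (x * y) = norm3 x * norm3 y.
Proof. by rewrite /norm3 !rmorphM /=; ring. Qed.

Lemma norm3_fixed x : tau x = x -> norm3 x = x ^+ 3.
Proof. by move=> Dx; rewrite /norm3 !Dx; ring. Qed.

End Norm.

Lemma norm3V (F : fieldType) (tau : {rmorphism F -> F}) x :
  norm3 tau x^-1 = (norm3 tau x)^-1.
Proof. by rewrite /norm3 !fmorphV !invfM. Qed.

Lemma norm3_eq0 (F : fieldType) (tau : {rmorphism F -> F}) x :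
  (norm3 tau x == 0) = (x == 0).
Proof. by rewrite /norm3 !mulf_eq0 !fmorph_eq0 !orbb. Qed.

Lemma cube_root_expr3 (R : comNzRingType) (w : R) :
  w ^+ 2 + w + 1 = 0 -> w ^+ 3 = 1.
Proof.
move=> w0; have -> : w ^+ 3 = (w ^+ 2 + w + 1) * (w - 1) + 1 by ring.
by rewrite w0 mul0r add0r.
Qed.

Lemma factor_cubes (R : comNzRingType) (w z t : R) : w ^+ 2 + w + 1 = 0 ->
  z ^+ 3 - t ^+ 3 = (z - t) * (z - w * t) * (z - w ^+ 2 * t).
Proof.
move=> w0; have -> : w ^+ 2 = - w - 1.
  by apply/eqP; rewrite -subr_eq0 -w0; apply/eqP; ring.
have -> : (z - t) * (z - w * t) * (z - (- w - 1) * t) =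
  z ^+ 3 - t ^+ 3 - (w ^+ 2 + w + 1) * (z - t) * t ^+ 2 by ring.
by rewrite w0 !mul0r subr0.
Qed.

(** The three inequalities force two of the numbers to be equal, and each of the three cases gives
    the divisibility. The sum [b + (a + a)] will be the multiplicity of a product (second factor) *
    (first factor)^2. *)
Lemma dvdn3_ultrametric (a b c m : nat) :
  (minn b c <= a)%N -> (minn c a <= b)%N -> (minn a b <= c)%N ->
  (a + b + c = 3 * m)%N -> (3 %| b + (a + a))%N.
Proof.
rewrite !geq_min => Ha Hb Hc S.
have [E|[E|E]] : a = b \/ a = c \/ b = c by lia.
- by apply/dvdnP; exists a; lia.
- by apply/dvdnP; exists m; lia.
- by apply/dvdnP; exists (2 * m - b)%N; lia.
Qed.

(** * Invariant polynomials, norms and interpolation between two values *)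

Section Order3.

Variables (F : fieldType) (tau : {rmorphism F -> F}).
Hypothesis tau3 : forall x, tau (tau (tau x)) = x.

Let tauP : {rmorphism {poly F} -> {poly F}} := map_poly tau.

Let tauP3 p : tauP (tauP (tauP p)) = p.
Proof. by apply/polyP => i; rewrite !coef_map /= tau3. Qed.

Let size_tau p : size (tauP p) = size p.
Proof. exact: size_map_poly. Qed.

Let dvd_tau p q : (tauP p %| tauP q) = (p %| q).
Proof. exact: dvdp_map. Qed.

Let eqp_tau p q : (tauP p %= tauP q) = (p %= q).
Proof. exact: eqp_map. Qed.

Let tauP_eq0 p : (tauP p == 0) = (p == 0).
Proof. exact: map_poly_eq0. Qed.

Let irr_tau P : irreducible_poly P -> irreducible_poly (tauP P).
Proof.
move=> irrP; split=> [|q q1 qP]; first by rewrite size_tau irrP.1.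
rewrite -[q]tauP3 eqp_tau; apply: irrP; first by rewrite !size_tau.
by rewrite -dvd_tau tauP3.
Qed.

Let multp_tau P h : irreducible_poly P -> tauP P %= P -> h != 0 ->
  multp P (tauP h) = multp P h.
Proof.
move=> irrP tP h0; apply/eqP; rewrite eqn_leq.
have E n : (n <= multp P (tauP h))%N = (n <= multp P h)%N.
  rewrite !multp_geq ?tauP_eq0 // -(eqp_dvdl _ (eqp_exp n tP)).
  by rewrite -rmorphXn dvd_tau.
by rewrite -E leqnn E leqnn.
Qed.

Lemma norm3_poly_neq0 p : p != 0 -> norm3 tauP p != 0.
Proof. by move=> p0; rewrite /norm3 !mulf_neq0 // !tauP_eq0. Qed.

Lemma multp_norm3 P h : irreducible_poly P -> tauP P %= P -> h != 0 ->
  multp P (norm3 tauP h) = (3 * multp P h)%N.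
Proof.
move=> irrP tP h0; rewrite /norm3 !multpM ?mulf_neq0 ?tauP_eq0 //.
by rewrite !multp_tau ?tauP_eq0 //; lia.
Qed.

(* An invariant prime whose multiplicity is divisible by 3 contributes a cube,
   the other primes come in orbits of length 3 *)
Lemma norm3_of_multp h : h != 0 -> tauP h = h ->
  (forall P, irreducible_poly P -> tauP P %= P -> (3 %| multp P h)%N) ->
  exists c B, h = c *: norm3 tauP B.
Proof.
have [n] := ubnP (size h); elim: n h => // n IHn h le_h h0 th v3.
have [le1|gt1] := leqP (size h) 1.
  by exists h`_0, 1; rewrite /norm3 !rmorph1 !mulr1 alg_polyC -size1_polyC.
have [P irrP Ph] := irredp_dvd_exists gt1.
have P0 := irredp_neq0 irrP.
have N0 := norm3_poly_neq0 P0.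
have tPh : tauP P %| h by rewrite -th dvd_tau.
have ttPh : tauP (tauP P) %| h by rewrite -th dvd_tau.
(* If [P] is invariant up to a unit, its norm is associate to [P ^+ 3], which divides [h] since the
   positive multiplicity is a multiple of 3. Otherwise the three conjugates of [P] are pairwise
   coprime and each divides the invariant [h]. The induction continues with the quotient [h']. *)
have /dvdpP[h' Dh] : norm3 tauP P %| h.
  have [tP|ntP] := boolP (tauP P %= P).
    have ttP : tauP (tauP P) %= P by apply: (eqp_trans _ tP); rewrite eqp_tau.
    have : P ^+ 3 %| h.
      rewrite -multp_geq // dvdn_leq ?v3 //.
      by rewrite multp_geq.
    rewrite (_ : P ^+ 3 = P * P * P); last by ring.
    rewrite /norm3 (eqp_dvdl _ (eqp_mulr _ (eqp_mull P tP))).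
    by rewrite (eqp_dvdl _ (eqp_mull _ ttP)).
  have c01 Q : irreducible_poly Q -> ~~ (tauP Q %= Q) -> coprimep Q (tauP Q).
    move=> irrQ; apply: contraNT; rewrite irredp_coprimep // negbK => QtQ.
    by rewrite eqp_sym irredp_eqp //; apply: irr_tau.
  have c02 : coprimep P (tauP (tauP P)).
    rewrite coprimep_sym -[P in coprimep _ P]tauP3 c01 ?eqp_tau //.
    by do 2!apply: irr_tau.
  rewrite !Gauss_dvdp ?Ph ?tPh ?ttPh ?c01 // coprimepMl c02 c01 ?eqp_tau //.
  exact: irr_tau.
have h'0 : h' != 0 by apply: contraNneq h0 => Dh'; rewrite Dh Dh' mul0r.
have tN : tauP (norm3 tauP P) = norm3 tauP P.
  by rewrite /norm3 !rmorphM /= tauP3; ring.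
have th' : tauP h' = h'.
  by apply: (mulIf N0); rewrite -{1}tN -rmorphM -Dh.
have lt_h' : (size h' < size h)%N.
  rewrite Dh size_mul // /norm3 !size_mul ?mulf_neq0 ?tauP_eq0 // !size_tau.
  have := irrP.1; have : (0 < size h')%N by rewrite size_poly_gt0.
  move: (size h') (size P) => m k; lia.
have [||c [B DB]] // := IHn h' _ h'0 th'.
- exact: leq_trans lt_h' _.
- move=> Q irrQ tQ; have := v3 Q irrQ tQ.
  by rewrite Dh multpM // multp_norm3 // dvdn_addl ?dvdn_mulr.
by exists c, (P * B); rewrite norm3M Dh DB -scalerAl mulrC.
Qed.

Variable omega : F.
Hypotheses (omega_root : omega ^+ 2 + omega + 1 = 0) (tau_omega : tau omega = omega).

(** The pair (Z, T) has value (z, t) at 0 and, reading off coefficients of degree [d], value [lam]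
    (omega z, t) at infinity. A suitable product of linear factors of Z^3 - T^3 is a constant [c]
    times a norm; dividing its constant term by its leading coefficient eliminates [c], and what
    remains is z^3 - t^3 up to a cube of an invariant element. As z^3 - t^3 is also [rho] times a
    norm, [rho] is a norm. *)
Lemma norm3_interpolation (d : nat) (Z T l : {poly F}) (rho lam z t : F) :
    map_poly tau Z = Z -> map_poly tau T = T ->
    Z ^+ 3 - T ^+ 3 = rho *: norm3 (map_poly tau) l ->
    (size Z <= d.+1)%N -> (size T <= d.+1)%N ->
    Z`_0 = z -> T`_0 = t -> Z`_d = lam * (omega * z) -> T`_d = lam * t ->
    lam != 0 -> z ^+ 3 != t ^+ 3 ->
  exists g, rho = norm3 tau g.
Proof.
move=> tZ tT eqn sZ sT Z0 T0 Zd Td lam0 zt.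
have om0 : omega != 0.
  by apply: contra_eq_neq omega_root => ->; rewrite expr0n /= !add0r oner_eq0.
pose a i := Z - omega ^+ i *: T.
have omP : omega%:P ^+ 2 + omega%:P + 1 = 0 :> {poly F}.
  by rewrite -[1]/(1%:P) -!rmorphXn -!rmorphD omega_root.
have Da : Z ^+ 3 - T ^+ 3 = a 0 * a 1 * a 2.
  by rewrite (factor_cubes Z T omP) /a expr0 scale1r !mul_polyC -rmorphXn mul_polyC.
have cube0 : z ^+ 3 - t ^+ 3 != 0 by rewrite subr_eq0.
have cf0 : (Z ^+ 3 - T ^+ 3)`_0 = z ^+ 3 - t ^+ 3.
  by rewrite coefB !exprS expr0 !coef0M coefC eqxx Z0 T0 !mulr1.
have N0 : Z ^+ 3 - T ^+ 3 != 0.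
  by apply: contraNneq cube0 => E; rewrite -cf0 E coef0.
have /norP[a01 a2] : ~~ ((a 0 * a 1 == 0) || (a 2 == 0)) by rewrite -mulf_eq0 -Da.
have /norP[a0 a1] : ~~ ((a 0 == 0) || (a 1 == 0)) by rewrite -mulf_eq0.
have /norP[rho0 l0] : ~~ ((rho == 0) || (norm3 tauP l == 0)).
  by rewrite -scaler_eq0 -eqn.
have {}l0 : l != 0 by apply: contraNneq l0 => ->; rewrite /norm3 !mul0r.
have ta i : tauP (a i) = a i.
  by rewrite /a rmorphB /= map_polyZ tZ tT rmorphXn tau_omega.
(* Up to cubes, [h] is (Z - omega T) / (Z - T) *)
pose h := a 1 * a 0 ^+ 2.
have h0 : h != 0 by rewrite mulf_neq0 ?expf_neq0.
have th : tauP h = h by rewrite /h rmorphM rmorphXn !ta.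
(* This relation among the three factors feeds [multp_min]; it holds because 1 + omega + omega^2 and
   1 + omega^2 + omega^4 both vanish. *)
have lin : 1 *: a 0 + omega *: a 1 + omega ^+ 2 *: a 2 = 0.
  rewrite /a; transitivity ((omega ^+ 2 + omega + 1) *: Z
      - (omega ^+ 2 + omega + 1) *: (((omega - 1) * omega + 1) *: T)).
    by rewrite -!mul_polyC !rmorphE; ring.
  by rewrite omega_root !scale0r subrr.
have om2 : omega ^+ 2 != 0 by rewrite expf_neq0.
have [|c [B DB]] := norm3_of_multp h0 th.
  move=> P irrP tP; rewrite /h expr2 !multpM ?mulf_neq0 //.
  have S : (multp P (a 0) + multp P (a 1) + multp P (a 2) = 3 * multp P l)%N.
    rewrite -multp_norm3 // -!multpM // -Da eqn -mul_polyC multpM ?polyC_eq0 //.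
      by rewrite multp_size1 // size_polyC rho0.
    by rewrite norm3_poly_neq0.
  have M0 := multp_min irrP (oner_neq0 _) om0 om2 lin a0 a1 a2.
  have M1 := multp_min irrP om0 om2 (oner_neq0 _) _ a1 a2 a0.
  have M2 := multp_min irrP om2 (oner_neq0 _) om0 _ a2 a0 a1.
  rewrite addrC addrA in M1; rewrite -addrA addrC in M2.
  exact: dvdn3_ultrametric M0 (M1 lin) (M2 lin) S.
have om3 := cube_root_expr3 omega_root.
move: (cube0); rewrite (factor_cubes z t omega_root) !mulf_eq0 !negb_or -!andbA.
case/and3P=> zt0 zt1 zt2.
have cfB (p : {poly F}) : (norm3 tauP p)`_0 = norm3 tau p`_0.
  by rewrite /norm3 !coef0M !coef_map.
have lcB (p : {poly F}) : lead_coef (norm3 tauP p) = norm3 tau (lead_coef p).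
  by rewrite /norm3 !lead_coefM !lead_coef_map.
have ad i : (a i)`_d = lam * (omega * z - omega ^+ i * t).
  by rewrite coefB coefZ Zd Td; ring.
have sa i : (size (a i) <= d.+1)%N.
  rewrite (leq_trans (size_polyD _ _)) // geq_max sZ size_polyN.
  exact: leq_trans (size_scale_leq _ _) sT.
have lc (p : {poly F}) : (size p <= d.+1)%N -> p`_d != 0 -> lead_coef p = p`_d.
  move=> sp pd; rewrite lead_coefE (_ : size p = d.+1) //; apply/eqP.
  by rewrite eqn_leq sp ltnNge; apply: contra pd => /leq_sizeP->.
have lc0 : lead_coef (a 0) = lam * omega * (z - omega ^+ 2 * t).
  have E : (a 0)`_d = lam * omega * (z - omega ^+ 2 * t).
    by rewrite ad -[X in _ = X]addr0 -[omega ^+ 0]om3; ring.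
  by rewrite -E lc // E !mulf_neq0.
have lc1 : lead_coef (a 1) = lam * omega * (z - t).
  have E : (a 1)`_d = lam * omega * (z - t) by rewrite ad expr1; ring.
  by rewrite -E lc // E !mulf_neq0.
have H0 : c * norm3 tau B`_0 = (z - omega * t) * (z - t) ^+ 2.
  rewrite -cfB -coefZ -DB /h expr2 !coef0M /a !coefB !coefZ Z0 T0; ring.
have Hd : c * norm3 tau (lead_coef B) =
    (lam * omega * (z - t)) * (lam * omega * (z - omega ^+ 2 * t)) ^+ 2.
  by rewrite -lcB -lead_coefZ -DB /h expr2 !lead_coefM lc0 lc1 expr2.
have E0 : z ^+ 3 - t ^+ 3 = rho * norm3 tau l`_0 by rewrite -cf0 eqn coefZ cfB.
have tz : tau z = z by rewrite -Z0 -coef_map tZ.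
have tt : tau t = t by rewrite -T0 -coef_map tT.
(* [lam] is the quotient of two invariant coefficients, taken from [T] when [t] is nonzero and from
   [Z] otherwise. *)
have tlam : tau lam = lam.
  have tlz : tau (lam * (omega * z)) = lam * (omega * z) by rewrite -Zd -coef_map tZ.
  have tlt : tau (lam * t) = lam * t by rewrite -Td -coef_map tT.
  have [t00|t_neq0] := eqVneq t 0.
    apply: (mulIf (_ : omega * z != 0)).
      by rewrite mulf_neq0 //; move: zt0; rewrite t00 subr0.
    by rewrite -{1}tau_omega -{1}tz -tlz !rmorphM.
  by apply: (mulIf t_neq0); rewrite -{1}tt -rmorphM.
(* The ratio of the two ends of [h] is (z - omega t)(z - t) / (lam^3 (z - omega^2 t)^2). Multiplying
   by [u ^+ 3], which is the norm of the invariant [u], gives z^3 - t^3. *)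
have [u [Du tu]] : exists u, u = lam * (z - omega ^+ 2 * t) /\ tau u = u.
  exists (lam * (z - omega ^+ 2 * t)).
  by rewrite rmorphM rmorphB rmorphM rmorphXn /= tau_omega tz tt tlam.
exists (u * B`_0 * (lead_coef B)^-1 * (l`_0)^-1).
have lB0 : norm3 tau l`_0 != 0.
  by apply: contraNneq cube0 => E; rewrite E0 E mulr0.
have cN0 : c * norm3 tau (lead_coef B) != 0 by rewrite Hd !(mulf_neq0, expf_neq0).
have [c0 NB0] : c != 0 /\ norm3 tau (lead_coef B) != 0.
  by apply/andP; rewrite -negb_or -mulf_eq0.
rewrite !norm3M !norm3V norm3_fixed //.
apply: (mulIf lB0); rewrite mulfVK // -E0.
apply: (mulIf cN0).
transitivity (u ^+ 3 * (c * norm3 tau B`_0)); last by field.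
rewrite H0 Hd Du (factor_cubes z t omega_root) -[RHS]mul1r -om3; ring.
Qed.

End Order3.

(** * Morphisms of fraction fields *)

Lemma sub_div (F : fieldType) (n d n' d' : F) : d != 0 -> d' != 0 ->
  n / d - n' / d' = (n * d' - n' * d) / (d * d').
Proof. by move=> d0 d'0; field; rewrite d0 d'0. Qed.

Section FractionMorphism.

Variable R : idomainType.
Local Notation "x %:F" := (@tofrac R x).

Lemma fraction_repr (x : {fraction R}) :
  x = (\n_(repr x))%:F / (\d_(repr x))%:F.
Proof.
rewrite -{1}[x]reprK; move: (repr x) => r.
have dF : (\d_r)%:F != 0 by rewrite tofrac_eq0 denom_ratioP.
apply: (mulIf dF); rewrite mulfVK //; unlock tofrac.
rewrite -[LHS]FracField.pi_mul; apply/eqmodP => /=.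
rewrite FracField.equivfE /FracField.mulf !numden_Ratio ?oner_neq0 ?mulr1
  ?denom_ratioP //.
by rewrite mulrC.
Qed.

Lemma fractionP (x : {fraction R}) :
  exists n d : R, d != 0 /\ x = n%:F / d%:F.
Proof.
exists \n_(repr x), \d_(repr x); split; first exact: denom_ratioP.
exact: fraction_repr.
Qed.

Section Extension.

Variables (F : fieldType) (f : {rmorphism R -> F}).
Hypothesis f_inj : forall x, f x = 0 -> x = 0.

(** Defined on the chosen representative; [extE] shows that any other fraction gives the same
    value. *)
Let ext (x : {fraction R}) : F := f (\n_(repr x)) / f (\d_(repr x)).

Let f_neq0 d : d != 0 -> f d != 0.
Proof. by apply: contra_neq => /f_inj. Qed.

Let extE n d : d != 0 -> ext (n%:F / d%:F) = f n / f d.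
Proof.
move=> d0; rewrite /ext; set n' := \n_(repr _); set d' := \d_(repr _).
have d'0 : d' != 0 by apply: denom_ratioP.
apply/eqP; rewrite eqr_div ?f_neq0 // -!rmorphM; apply/eqP; congr (f _).
apply/eqP; rewrite -tofrac_eq !tofracM; apply/eqP.
apply/eqP; rewrite -eqr_div ?tofrac_eq0 //; apply/eqP.
by rewrite /n' /d'; rewrite -fraction_repr.
Qed.

Lemma fraction_extension :
  exists g : {rmorphism {fraction R} -> F}, forall a, g a%:F = f a.
Proof.
have ext_add : zmod_morphism ext.
  move=> x y; have [n [d [d0 ->]]] := fractionP x.
  have [n' [d' [d'0 ->]]] := fractionP y.
  have -> : n%:F / d%:F - n'%:F / d'%:F = (n * d' - n' * d)%:F / (d * d')%:F.
    by rewrite tofracB !tofracM sub_div ?tofrac_eq0.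
  by rewrite !extE ?mulf_neq0 // rmorphB !rmorphM sub_div ?f_neq0.
have ext1 : ext 1 = 1.
  by rewrite -[1]divr1 -tofrac1 extE ?oner_neq0 // rmorph1 divr1.
have ext_mul : monoid_morphism ext.
  split=> // x y; have [n [d [d0 ->]]] := fractionP x.
  have [n' [d' [d'0 ->]]] := fractionP y.
  by rewrite mulf_div -!tofracM !extE ?mulf_neq0 // !rmorphM mulf_div.
pose gA := GRing.isZmodMorphism.Build _ _ ext ext_add.
pose gM := GRing.isMonoidMorphism.Build _ _ ext ext_mul.
pose g : {rmorphism {fraction R} -> F} := HB.pack ext gA gM.
exists g => a; rewrite /g /=.
by rewrite -[a%:F]divr1 -tofrac1 extE ?oner_neq0 // rmorph1 divr1.
Qed.

End Extension.

Lemma fraction_automorphism (t : {rmorphism R -> R}) :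
    (forall x, t (t (t x)) = x) ->
  exists g : {rmorphism {fraction R} -> {fraction R}},
    (forall a, g a%:F = (t a)%:F) /\ forall x, g (g (g x)) = x.
Proof.
move=> t3.
have [|g Dg] := @fraction_extension {fraction R} (@tofrac R \o t).
  move=> x /= /eqP; rewrite tofrac_eq0 => /eqP tx0.
  by rewrite -[x]t3 tx0 !rmorph0.
exists g; split=> // x; have [n [d [d0 ->]]] := fractionP x.
by rewrite !fmorph_div !(Dg, t3) /= !(Dg, t3).
Qed.

(** Clearing denominators moves a norm equation into [R], where leading coefficients or
    multiplicities can be compared. *)
Lemma norm3_fraction (t : {rmorphism R -> R})
    (g : {rmorphism {fraction R} -> {fraction R}}) a b x :
    (forall y, g y%:F = (t y)%:F) -> a != 0 -> b != 0 ->
    a%:F / b%:F = norm3 g x ->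
  exists p q, [/\ p != 0, q != 0 & a * norm3 t q = b * norm3 t p].
Proof.
move=> Dg a0 b0; have [p [q [q0 ->]]] := fractionP x => E.
have DN y : norm3 g y%:F = (norm3 t y)%:F by rewrite /norm3 !Dg !tofracM.
have Nq : (norm3 t q)%:F != 0.
  by rewrite -DN norm3_eq0 tofrac_eq0.
exists p, q; split=> //.
  apply: contraNneq a0 => p0; move: E; rewrite p0 norm3M DN /norm3 rmorph0 !mul0r.
  by move/eqP; rewrite mulf_eq0 invr_eq0 !tofrac_eq0 (negPf b0) orbF.
apply/eqP; rewrite -tofrac_eq (tofracM a) (tofracM b); apply/eqP.
move: E; rewrite norm3M norm3V !DN => /(congr1 (fun u => u * b%:F * (norm3 t q)%:F)).
rewrite mulfVK ?tofrac_eq0 // => ->.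
by rewrite mulrAC mulfVK // mulrC.
Qed.

End FractionMorphism.

(** * Evaluation of forms *)

Section Evaluation.

Variables (n : nat) (R : comNzRingType).

Lemma eq_mmap (S : comNzRingType) (f f' : R -> S) (h h' : 'I_n -> S) p :
  f =1 f' -> h =1 h' -> mmap f h p = mmap f' h' p.
Proof.
by move=> ff hh; apply: eq_bigr => m _; rewrite ff (mmap1_eq m hh).
Qed.

Lemma rmorph_mmap (S S' : comNzRingType) (psi : {rmorphism S -> S'})
    (f : {rmorphism R -> S}) (h : 'I_n -> S) p :
  psi (mmap f h p) = mmap (psi \o f) (psi \o h) p.
Proof.
rewrite /mmap rmorph_sum; apply: eq_bigr => m _ /=.
rewrite rmorphM /mmap1 rmorph_prod; congr (_ * _); apply: eq_bigr => i _.
by rewrite rmorphXn.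
Qed.

Lemma mmap_comp_mpoly m (S : comNzRingType) (f : {rmorphism R -> S})
    (h : 'I_m -> S) (g : n.-tuple {mpoly R[m]}) p :
  mmap f h (p \mPo g) = mmap f (fun i => mmap f h (tnth g i)) p.
Proof.
rewrite /comp_mpoly rmorph_mmap; apply: eq_mmap => // c /=.
by rewrite mmapC.
Qed.

(** Phrased with degree bounds rather than leading coefficients, since the coefficients in degrees
    [a] and [b] may vanish. *)
Lemma coefM_top (S : comNzRingType) (p q : {poly S}) a b :
  (size p <= a.+1)%N -> (size q <= b.+1)%N ->
  (size (p * q)%R <= (a + b).+1)%N /\ (p * q)`_(a + b) = p`_a * q`_b.
Proof.
move=> sp sq; split.
  by apply: leq_trans (size_polyMleq _ _) _; lia.
rewrite coefM (bigD1 (inord a)) //= inordK ?ltnS ?leq_addr // addKn.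
rewrite big1 ?addr0 // => i ia.
have [lt_ia|lt_ai|E] := ltngtP i a.
- by rewrite [q`__]nth_default ?mulr0 //; apply: leq_trans sq _; lia.
- by rewrite [p`__]nth_default ?mul0r //; apply: leq_trans sp _.
- by case/eqP: ia; apply: val_inj; rewrite /= E inordK // ltnS leq_addr.
Qed.

Lemma coefX_top (S : comNzRingType) (p : {poly S}) a j :
  (size p <= a.+1)%N ->
  (size (p ^+ j) <= (a * j).+1)%N /\ (p ^+ j)`_(a * j) = p`_a ^+ j.
Proof.
move=> sp; elim: j => [|j [IHs IHc]].
  by rewrite muln0 !expr0 size_poly1 coefC eqxx.
by rewrite mulnS !exprS -IHc; apply: coefM_top.
Qed.

Lemma mmap1_top (S : comNzRingType) (h : 'I_n -> {poly S}) c m :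
  (forall i, size (h i) <= c.+1)%N ->
  (size (mmap1 h m) <= (c * mdeg m).+1)%N /\
  (mmap1 h m)`_(c * mdeg m) = mmap1 (fun i => (h i)`_c) m.
Proof.
move=> sh; rewrite mdegE big_distrr /= /mmap1.
elim/big_ind3: _ => [|p a u q b v [sp pa] [sq qb]|i _].
- by rewrite size_poly1 coefC eqxx.
- by have [s ->] := coefM_top sp sq; rewrite pa qb.
- exact: coefX_top.
Qed.

(** As [c] is positive, only monomials of degree exactly [d] reach degree [c * d]. This serves both
    to find the point at infinity of a parametrized curve and to prove algebraic independence. *)
Lemma mmap_top (S : comNzRingType) (f : {rmorphism R -> S})
    (h : 'I_n -> {poly S}) c d p :
  (forall i, size (h i) <= c.+1)%N -> {in msupp p, forall m, mdeg m <= d}%N ->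
  (0 < c)%N ->
  (size (mmap (polyC \o f) h p) <= (c * d).+1)%N /\
  (mmap (polyC \o f) h p)`_(c * d) =
    mmap f (fun i => (h i)`_c) (pihomog mdeg d p).
Proof.
move=> sh pd c0; split.
  rewrite /mmap (leq_trans (size_sum _ _ _)) //.
  rewrite big_seq; apply/bigmax_leqP_seq => m mp _ /=.
  have [s _] := mmap1_top m sh; rewrite mul_polyC.
  apply: leq_trans (size_scale_leq _ _) (leq_trans s _).
  by rewrite ltnS leq_mul2l pd ?orbT.
rewrite pihomogE raddf_sum /= [in LHS]/mmap coef_sum [RHS]big_mkcond /=.
rewrite [LHS]big_seq [RHS]big_seq.
apply: eq_bigr => m mp; rewrite coefCM.
have [s E] := mmap1_top m sh.
case: eqVneq => [<-|md]; first by rewrite mmapZ mmapX E.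
rewrite nth_default ?mulr0 //; apply: leq_trans s _.
by rewrite ltn_pmul2l // ltn_neqAle md pd.
Qed.

End Evaluation.

Lemma dhomog_comp n l (R : comNzRingType) d e (p : {mpoly R[n]})
    (q : n.-tuple {mpoly R[l]}) :
  p \is d.-homog -> (forall i, tnth q i \is e.-homog) ->
  p \mPo q \is (e * d)%N.-homog.
Proof.
move=> hp hq; rewrite comp_mpolyEX big_seq rpred_sum // => m mp.
apply: dhomogZ; rewrite -(dhomog_mf hp mp) /= comp_mpolyX mdegE big_distrr /=.
elim/big_ind2: _ => [|p1 a p2 b h1 h2|i _].
- exact: dhomog1.
- exact: dhomogM.
- exact: dhomogMn.
Qed.

(** * Rational diagonal cubic surfaces *)

Section DiagonalCubic.

Variables (K : fieldType) (a b c d omega : K).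
Hypotheses (a0 : a != 0) (b0 : b != 0) (c0 : c != 0).
Hypothesis omega_root : omega ^+ 2 + omega + 1 = 0.

Notation Y i := ('X_(inord i) : {mpoly K[4]}).

Definition diagonal_cubic : {mpoly K[4]} :=
  a *: Y 0 ^+ 3 + b *: Y 1 ^+ 3 + c *: Y 2 ^+ 3 + d *: Y 3 ^+ 3.

Lemma mmap_diagonal_cubic (S : comNzRingType) (f : {rmorphism K -> S})
    (v : 'I_4 -> S) :
  mmap f v diagonal_cubic = f a * v (inord 0) ^+ 3 + f b * v (inord 1) ^+ 3
    + f c * v (inord 2) ^+ 3 + f d * v (inord 3) ^+ 3.
Proof. by rewrite !rmorphD /= !mmapZ !rmorphXn /= !mmapX !mmap1U. Qed.

Let omega3 := cube_root_expr3 omega_root.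

(** The map z |-> u z on the third coordinate; it preserves the cubic when [u] is a cube root of
    unity. *)
Definition rotation (u : K) : 4.-tuple {mpoly K[4]} :=
  [tuple if i == inord 2 then u *: 'X_i else 'X_i | i < 4].

Lemma rotation_homog u i : tnth (rotation u) i \is 1.-homog.
Proof.
have hX : ('X_i : {mpoly K[4]}) \is 1.-homog.
  by rewrite dhomogX; apply/eqP; exact: mdeg1.
by rewrite tnth_mktuple; case: ifP => _ //; apply: dhomogZ.
Qed.

Let comp_rotation u (j : 'I_4) :
  'X_j \mPo rotation u = if j == inord 2 then u *: 'X_j else 'X_j.
Proof. by rewrite comp_mpolyXU -tnth_nth tnth_mktuple. Qed.

Lemma diagonal_cubic_rotation u : u ^+ 3 = 1 ->
  diagonal_cubic \mPo rotation u = diagonal_cubic.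
Proof.
move=> u3; rewrite /diagonal_cubic !rmorphD /= !comp_mpolyZ !rmorphXn /=.
rewrite !comp_rotation -!val_eqE /= !inordK //=.
by rewrite exprZn u3 scale1r.
Qed.

Lemma comp_rotationK u v p : v * u = 1 ->
  (p \mPo rotation u) \mPo rotation v = p.
Proof.
move=> vu; rewrite /comp_mpoly mmap_comp_mpoly -[RHS]comp_mpoly_id.
apply: eq_mmap => // i; rewrite !tnth_mktuple.
rewrite -/(comp_mpoly _ _); case: ifP => i2.
  by rewrite comp_mpolyZ comp_rotation i2 scalerA mulrC vu scale1r.
by rewrite comp_rotation i2.
Qed.

Lemma in_ideal1 n (F p : {mpoly K[n.+1]}) :
  in_ideal [:: F] p <-> exists u, p = u * F.
Proof.
split=> [[u ->]|[u ->]]; first by exists (u ord0); rewrite big_ord1.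
by exists (fun=> u); rewrite big_ord1.
Qed.

Lemma in_ideal0 n (p : {mpoly K[n.+1]}) : in_ideal [::] p <-> p = 0.
Proof. by split=> [[u ->]|->]; [|exists (fun=> 0)]; rewrite big_ord0. Qed.

(** At the point (X : 0 : 1 : 0) the left side is 1, whereas the cubic becomes a X^3 + c, of degree
    3. *)
Lemma diagonal_cubic_ndvd u e :
  Y 2 ^+ 3 + e *: Y 3 ^+ 3 <> u * diagonal_cubic.
Proof.
pose v (i : 'I_4) : {poly K} :=
  if i == inord 0 then 'X else if i == inord 2 then 1 else 0.
move=> /(congr1 (mmap (@polyC K) v)).
rewrite rmorphM /= mmap_diagonal_cubic rmorphD /= mmapZ !rmorphXn /= !mmapX !mmap1U.
rewrite /v -!val_eqE /= !inordK //= expr1n !expr0n /= !mulr0 !addr0 mulr1.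
move/(congr1 (size : {poly K} -> nat)); rewrite size_poly1.
set w := mmap _ _ _; have szF : size (a%:P * 'X^3 + c%:P) = 4%N.
  by rewrite mul_polyC size_polyDl size_scale ?size_polyXn // size_polyC c0.
have F0 : a%:P * 'X^3 + c%:P != 0 by rewrite -size_poly_gt0 szF.
have [->|w0] := eqVneq w 0; first by rewrite mul0r size_poly0.
rewrite size_mul // szF addnS /= => /eqP.
by have := w0; rewrite -size_poly_gt0; case: (size w) => [|s] //; rewrite !addnS.
Qed.


(** * The line through a generic point and its rotated image *)

Section GenericLine.

Variables (L : fieldType) (iota : {rmorphism K -> L}) (xi : 'I_3 -> L).
Variables (tau : {rmorphism L -> L}) (w v : L).
Hypothesis xi_free : forall p, mmap iota xi p = 0 -> p = 0.
Hypothesis tau3 : forall x, tau (tau (tau x)) = x.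
Hypothesis tau_iota : forall x, tau (iota x) = iota x.
Hypothesis tau_xi : forall i, tau (xi i) = xi i.
Hypotheses (w3 : w ^+ 3 = - iota (d / c)) (tau_w : tau w = w).
Hypotheses (v3 : v ^+ 3 = - iota (a / b)) (tau_v : tau v = iota omega * v).

Let ev (p : {mpoly K[3]}) : L := mmap iota xi p.

Let tau_mmap n (h : 'I_n -> L) p : (forall i, tau (h i) = h i) ->
  tau (mmap iota h p) = mmap iota h p.
Proof. by move=> th; rewrite rmorph_mmap; apply: eq_mmap => // x /=; rewrite tau_iota. Qed.

(** The cube roots [w] and [v] turn the equation into z^3 - (w x4)^3 = -(b/c) (x2^3 - (v x1)^3), and
    the last factor is the norm of x2 - v x1 because [tau] multiplies [v] by omega. By [xi_free],
    [xi] is a generic point of the plane, so [norm3_interpolation] applies along a line starting at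
    [xi]. *)
Lemma rational_diagonal_cubic_norm :
  rational_surface [:: diagonal_cubic] ->
  exists g, - iota (b / c) = norm3 tau g.
Proof.
case=> f [g [[[[df hf] _ _] domf] [[[dg hg] [i0 gi0] gF] domg] gf _]].
have {gi0} gi0 : tnth g i0 != 0.
  by apply/eqP => E; apply: gi0; apply/in_ideal0.
have omK : omega ^+ 2 * omega = 1 by rewrite -exprSr.
have Fg : diagonal_cubic \mPo g = 0 by apply/in_ideal0/gF; rewrite inE.
(* [P] is the generic point of the surface, [sP] its image under the rotation
   and [s] the point of the plane corresponding to [sP] *)
pose P i := ev (tnth g i).
have FP : mmap iota P diagonal_cubic = 0.
  by rewrite -mmap_comp_mpoly Fg rmorph0.
have tP i : tau (P i) = P i by apply: tau_mmap.
pose sP i := if i == inord 2 then iota omega * P i else P i.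
have DsP i : mmap iota P (tnth (rotation omega) i) = sP i.
  rewrite tnth_mktuple /sP; case: ifP => _; last by rewrite mmapX mmap1U.
  by rewrite mmapZ mmapX mmap1U.
have FsP : mmap iota sP diagonal_cubic = 0.
  rewrite -{}FP -{2}(diagonal_cubic_rotation omega3) mmap_comp_mpoly.
  by apply: eq_mmap => // i; rewrite DsP.
have tsP i : tau (sP i) = sP i.
  by rewrite /sP; case: ifP => _; rewrite ?rmorphM ?tau_iota tP.
pose s j := mmap iota sP (tnth f j).
have ts j : tau (s j) = s j by apply: tau_mmap.
(* The map [g] must be defined at [s]. If this coordinate vanished, dominance of [g] would put [h]
   in the ideal of the cubic; undoing the rotation puts [tnth g i0 \mPo f] there, and dominance of
   [f] then makes [tnth g i0] zero. *)
have gs0 : mmap iota s (tnth g i0) != 0.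
  pose h := (tnth g i0 \mPo f) \mPo rotation omega.
  have hh : h \is (1 * (df * dg))%N.-homog.
    by apply: dhomog_comp (rotation_homog _); apply: dhomog_comp.
  have -> : mmap iota s (tnth g i0) = ev (h \mPo g).
    rewrite /ev /h !mmap_comp_mpoly; apply: eq_mmap => // j.
    by rewrite /s; apply: eq_mmap => // i; rewrite -DsP.
  apply/eqP => /xi_free/in_ideal0/(domg _ _ hh)/in_ideal1[u Du].
  case/eqP: gi0; apply/in_ideal0; apply: (domf _ _ (hg i0)).
  apply/in_ideal1; exists (u \mPo rotation (omega ^+ 2)).
  rewrite -[LHS](comp_rotationK _ omK) -/h Du rmorphM /=.
  by rewrite (diagonal_cubic_rotation (_ : _ ^+ 3 = 1)) // exprAC omega3 expr1n.
(* The composite of [f] and [g] is the identity only projectively; [lam] is the factor by which it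
   rescales [sP]. *)
pose lam := mmap iota s (tnth g i0) / sP i0.
have P0 : P i0 != 0 by apply: contra_neq gi0; apply: xi_free.
have iom0 : iota omega != 0.
  apply: contra_eq_neq omK => /eqP; rewrite fmorph_eq0 => /eqP->.
  by rewrite mulr0 eq_sym oner_neq0.
have sP0 : sP i0 != 0 by rewrite /sP; case: ifP => // _; rewrite mulf_neq0.
have lam0 : lam != 0 by rewrite mulf_neq0 ?invr_eq0.
have gs j : mmap iota s (tnth g j) = lam * sP j.
  have /in_ideal1[u /(congr1 (mmap iota sP))] := gf i0 j.
  rewrite rmorphM /= FsP mulr0 rmorphB !rmorphM /= !tnth_mktuple.
  rewrite !mmap_comp_mpoly !mmapX !mmap1U => /eqP; rewrite subr_eq0 => /eqP E.
  by rewrite /lam mulrAC E mulfK.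
have c0L : iota c != 0 by rewrite fmorph_eq0.
have b0L : iota b != 0 by rewrite fmorph_eq0.
(* The form z^3 - t^3 is not in the ideal of the cubic, so by dominance of [g] it does not vanish at
   [P]. *)
have zt : P (inord 2) ^+ 3 != (w * P (inord 3)) ^+ 3.
  pose h := Y 2 ^+ 3 + (d / c) *: Y 3 ^+ 3.
  have hh : h \is 3.-homog.
    have hX (i : 'I_4) : ('X_i ^+ 3 : {mpoly K[4]}) \is (1 * 3).-homog.
      by apply: dhomogMn; rewrite dhomogX; apply/eqP; apply: mdeg1.
    by apply: dhomogD (hX _) _; apply: dhomogZ; apply: hX.
  rewrite -subr_eq0 exprMn w3 mulNr opprK.
  have -> : P (inord 2) ^+ 3 + iota (d / c) * P (inord 3) ^+ 3 = ev (h \mPo g).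
    by rewrite /ev mmap_comp_mpoly rmorphD /= mmapZ !rmorphXn /= !mmapX !mmap1U.
  apply/eqP => /xi_free/in_ideal0/(domg _ _ hh)/in_ideal1[u].
  exact: diagonal_cubic_ndvd.
(* The line [xi] + r [s], with ['X] for r. Its image [Q] under [g] lies on the cubic, has value [P]
   at r = 0 and coefficient g([s]) = [lam] [sP] in degree [dg]. *)
pose line (j : 'I_3) : {poly L} := (xi j)%:P + s j *: 'X.
pose Q i := mmap (polyC \o iota) line (tnth g i).
have FQ : mmap (polyC \o iota) Q diagonal_cubic = 0.
  by rewrite -mmap_comp_mpoly Fg rmorph0.
have Q0 i : (Q i)`_0 = P i.
  rewrite -horner_coef0 -[LHS]/(horner_eval 0 _) rmorph_mmap.
  apply: eq_mmap => [x|j] /=; first by rewrite horner_evalE hornerC.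
  by rewrite horner_evalE /line !hornerE.
have size_line j : (size (line j) <= 2)%N.
  rewrite (leq_trans (size_polyD _ _)) // geq_max (leq_trans (size_polyC_leq1 _)) //.
  by rewrite (leq_trans (size_scale_leq _ _)) // size_polyX.
have line1 j : (line j)`_1 = s j by rewrite coefD coefC coefZ coefX mulr1 add0r.
have Qtop i : (size (Q i) <= dg.+1)%N /\ (Q i)`_dg = lam * sP i.
  have top : {in msupp (tnth g i), forall m, mdeg m <= dg}%N.
    by move=> m /(dhomog_mf (hg i))/= ->.
  have := mmap_top iota size_line top (ltn0Sn 0); rewrite !mul1n -gs => -[? ->].
  split=> //; rewrite pihomog_dE //; exact: eq_mmap.
have tQ i : map_poly tau (Q i) = Q i.
  rewrite rmorph_mmap; apply: eq_mmap => [x|j] /=.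
    by rewrite map_polyC /= tau_iota.
  by rewrite /line rmorphD /= map_polyC map_polyZ map_polyX /= tau_xi ts.
pose Z := Q (inord 2); pose T := w *: Q (inord 3).
pose l := Q (inord 1) - v *: Q (inord 0).
have iom_root : iota omega ^+ 2 + iota omega + 1 = 0.
  by rewrite -(rmorph1 iota) -rmorphXn -!rmorphD omega_root rmorph0.
apply: (@norm3_interpolation L tau tau3 (iota omega) iom_root _ dg Z T l _ lam
  (P (inord 2)) (w * P (inord 3))) => //.
- exact: tQ.
- by rewrite /T map_polyZ /= tau_w tQ.
- have omP : (iota omega)%:P ^+ 2 + (iota omega)%:P + 1 = 0 :> {poly L}.
    by rewrite -polyC_exp -polyC1 -!polyCD iom_root.
  have -> : norm3 (map_poly tau) l = Q (inord 1) ^+ 3 - (v *: Q (inord 0)) ^+ 3.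
    rewrite (factor_cubes _ _ omP) /norm3 /l !rmorphB /= !map_polyZ /= !tQ.
    rewrite !tau_v rmorphM /= tau_v tau_iota -polyC_exp !mul_polyC !scalerA.
    by rewrite mulrA -expr2.
  rewrite /T !exprZn w3 v3 !fmorph_div.
  move: FQ; rewrite mmap_diagonal_cubic /= !mul_polyC.
  set X0 := Q (inord 0) ^+ 3; set X1 := Q (inord 1) ^+ 3.
  set X2 := Z ^+ 3; set X3 := Q (inord 3) ^+ 3 => E.
  apply/eqP; rewrite -subr_eq0; apply/eqP; apply: (scalerI c0L).
  rewrite scaler0 -{}E !(scalerBr, scalerDr, scaleNr, scalerN, opprK, opprD) !scalerA.
  rewrite [iota d / _]mulrC mulVKf // [iota b / _]mulrC mulVKf //.
  rewrite [iota a / _]mulrC mulVKf //.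
  by ring.
- by have [] := Qtop (inord 2).
- by have [sz _] := Qtop (inord 3); apply: leq_trans (size_scale_leq _ _) sz.
- exact: Q0.
- by rewrite coefZ Q0.
- by have [_ ->] := Qtop (inord 2); rewrite /sP eqxx.
- have [_] := Qtop (inord 3); rewrite coefZ => ->.
  by rewrite /sP -val_eqE /= !inordK //= mulrCA.
Qed.

End GenericLine.

End DiagonalCubic.

(** * The field k(theta, w) *)

Lemma norm3_quotient (F : fieldType) (tau : {rmorphism F -> F}) rho x y :
  y != 0 -> rho * norm3 tau y = norm3 tau x -> rho = norm3 tau (x / y).
Proof.
by move=> y0 E; rewrite norm3M norm3V -E mulfK // norm3_eq0.
Qed.

Lemma mlead_map_mpoly n (F G : fieldType) (f : {rmorphism F -> G}) (p : {mpoly F[n]}) :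
  mlead (map_mpoly f p) = mlead p.
Proof.
have [->|p0] := eqVneq p 0; first by rewrite rmorph0 !mlead0.
have E m : (m \in msupp (map_mpoly f p)) = (m \in msupp p).
  by rewrite !mcoeff_msupp mcoeff_map_mpoly fmorph_eq0.
have fp0 : map_mpoly f p != 0.
  by have := mlead_supp p0; rewrite -E; apply: contraTneq => ->; rewrite msupp0.
by apply: le_anti; rewrite !msupp_le_mlead ?E ?mlead_supp // -E mlead_supp.
Qed.

Lemma mleadcM_idomain n (R : idomainType) (p q : {mpoly R[n]}) :
  mleadc (p * q) = mleadc p * mleadc q.
Proof.
have [->|p0] := eqVneq p 0; first by rewrite mul0r mlead0 !mcoeff0 mul0r.
have [->|q0] := eqVneq q 0; first by rewrite mulr0 mlead0 !mcoeff0 mulr0.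
rewrite (mleadM p0 q0); exact: mleadcM.
Qed.

(** Descent from a purely transcendental extension: after clearing denominators, take leading
    coefficients, which are multiplicative and commute with [tau]. *)
Lemma norm3_fraction_mpoly n (F : fieldType) (tau : {rmorphism F -> F})
    (g : {rmorphism {fraction {mpoly F[n]}} -> {fraction {mpoly F[n]}}}) rho x :
    (forall p, g (tofrac p) = tofrac (map_mpoly tau p)) ->
    rho != 0 -> tofrac rho%:MP = norm3 g x ->
  exists y, rho = norm3 tau y.
Proof.
move=> Dg rho0 E.
have rhoC : (rho%:MP : {mpoly F[n]}) != 0 by rewrite mpolyC_eq0.
have [|p [q [p0 q0 {}E]]] := norm3_fraction Dg rhoC (oner_neq0 _) (x := x).
  by rewrite tofrac1 divr1.
have lct (u : {mpoly F[n]}) : mleadc (map_mpoly tau u) = tau (mleadc u).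
  by rewrite mlead_map_mpoly mcoeff_map_mpoly.
have lead (r : {mpoly F[n]}) :
    mleadc (norm3 (map_mpoly tau) r) = norm3 tau (mleadc r).
  by rewrite /norm3 (mleadcM_idomain (r * _)) (mleadcM_idomain r)
    (lct (map_mpoly tau r)) (lct r).
exists (mleadc p / mleadc q); apply: norm3_quotient; first by rewrite mleadc_eq0.
rewrite -(lead p) -[in LHS](lead q); move: E; rewrite mul1r => <-.
by rewrite (mleadcM_idomain rho%:MP) mleadcC.
Qed.

Section ValuationAtOne.

Variables (M : fieldType) (tau : {rmorphism M -> M}) (e : M).
Hypotheses (e0 : e != 0) (e2 : e ^+ 2 != 1) (three : 3%:R != 0 :> M).

(** At the invariant prime ['X - 1] the numerator has multiplicity 1, the root being simple as 3 is
    nonzero, and the denominator has multiplicity 0 as [e ^+ 2] differs from 1. Norms contribute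
    multiples of 3. *)
Lemma not_norm3_at_one
    (g : {rmorphism {fraction {poly M}} -> {fraction {poly M}}}) x :
    (forall p, g (tofrac p) = tofrac (map_poly tau p)) ->
  tofrac (e ^+ 2 *: ('X^3 - 1)) / tofrac ('X^3 - (e ^+ 2)%:P) <> norm3 g x.
Proof.
move=> Dg E.
have irr := irredp_XsubC (1 : M); set P := 'X - _ in irr.
have tP : map_poly tau P %= P.
  by rewrite rmorphB /= map_polyX map_polyC /= rmorph1 eqpxx.
have nroot (q : {poly M}) : (P %| q) = (q.[1] == 0) by rewrite dvdp_XsubCl.
have vA : multp P (e ^+ 2 *: ('X^3 - 1)) = 1%N.
  have -> : e ^+ 2 *: ('X^3 - 1) = P ^+ 1 * (e ^+ 2 *: ('X ^+ 2 + 'X + 1)).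
    by rewrite -!mul_polyC /P; ring.
  rewrite multp_eq // nroot !hornerE expr1n mulf_neq0 ?expf_neq0 //.
  by rewrite (_ : 1 + 1 + 1 = 3%:R) //; ring.
have vB : multp P ('X^3 - (e ^+ 2)%:P) = 0%N.
  rewrite -[_ - _]mul1r -(expr0 P) multp_eq // nroot !hornerE expr1n.
  by rewrite subr_eq0 eq_sym.
have A0 : e ^+ 2 *: ('X^3 - 1) != 0 :> {poly M}.
  by rewrite scaler_eq0 expf_eq0 (negPf e0) /= -size_poly_gt0 size_XnsubC.
have B0 : 'X^3 - (e ^+ 2)%:P != 0 :> {poly M}.
  by rewrite -size_poly_gt0 size_XnsubC.
have [p [q [p0 q0]]] := norm3_fraction Dg A0 B0 E.
move/(congr1 (multp P)).
rewrite (multpM irr A0 (norm3_poly_neq0 _ q0)).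
rewrite (multpM irr B0 (norm3_poly_neq0 _ p0)).
by rewrite !multp_norm3 // vA vB; lia.
Qed.

End ValuationAtOne.

(** * Embedding k(s3, s4) into rational functions of w *)

Section Embedding.

Variables (k M : fieldType) (j : {rmorphism k -> M}) (e : M).
Hypothesis e_trans : forall (I : {poly k}), (map_poly j I).[e] = 0 -> I = 0.

Let e0 : e != 0.
Proof.
apply/eqP => E; have /eqP := oner_neq0 {poly k}.
have /e_trans/eqP : (map_poly j 'X).[e] = 0 by rewrite map_polyX hornerX.
by rewrite polyX_eq0.
Qed.

Let e1 : e - 1 != 0.
Proof.
apply/eqP => E.
have /e_trans/eqP : (map_poly j ('X - 1%:P)).[e] = 0.
  by rewrite rmorphB /= map_polyX map_polyC /= rmorph1 !hornerE.
by rewrite polyXsubC_eq0.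
Qed.

(* s3 and s4 as polynomials in w *)
Definition param (i : 'I_2) : {poly M} :=
  if i == inord 0 then (e - 1)^-1 *: ('X^3 - 1)
  else (e * (e - 1))^-1 *: ('X^3 - e%:P).

(* The monomial s3^i s4^j has degree 3 (i + j) in w, with leading coefficient
   e^i / (e (e - 1))^(i + j): for i + j fixed these are independent over k *)
Lemma param_free p : mmap (polyC \o j) param p = 0 -> p = 0.
Proof.
move=> E; apply/eqP; apply: contraTT isT => p0.
pose d := mdeg (mlead p).
have size_param i : (size (param i) <= 4)%N.
  rewrite /param; case: ifP => _.
    by rewrite (leq_trans (size_scale_leq _ _)) // size_XnsubC.
  by rewrite (leq_trans (size_scale_leq _ _)) // size_XnsubC.
have top : {in msupp p, forall m, mdeg m <= d}%N.
  by move=> m /msize_mdeg_lt; rewrite -mlead_deg.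
have [_] := mmap_top j size_param top (ltn0Sn 2).
(* The part of [p] of top degree [d], dehomogenized by keeping only the exponent of s3. Up to a
   nonzero factor its value at [e] is the top coefficient in w. *)
pose I := \sum_(m <- msupp p | mdeg m == d) p@_m *: 'X^(m ord0).
have mdeg2 (m : 'X_{1..2}) : mdeg m = (m ord0 + m (lift ord0 ord0))%N.
  by rewrite mdegE !big_ord_recl big_ord0 addn0.
have -> : mmap j (fun i => (param i)`_3) (pihomog mdeg d p) =
    (e * (e - 1)) ^- d * (map_poly j I).[e].
  rewrite pihomogE raddf_sum /= rmorph_sum horner_sum big_distrr /=.
  apply: eq_bigr => m /eqP <-; rewrite mmapZ mmapX /mmap1 !big_ord_recl big_ord0 mulr1.
  rewrite map_polyZ map_polyXn hornerZ hornerXn [RHS]mulrCA; congr (_ * _).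
  rewrite /param -!val_eqE /= !inordK //= !coefZ !coefB !coefXn !(coefC, coef1) /=.
  have -> : (e - 1)^-1 = (e * (e - 1))^-1 * e by rewrite invfM mulrAC mulVf ?mul1r.
  by rewrite !subr0 !mulr1 mdeg2 -exprVn exprMn exprD mulrAC.
rewrite E coef0 => /esym/eqP; rewrite mulf_eq0 invr_eq0 expf_eq0.
rewrite mulf_eq0 (negPf e0) (negPf e1) andbF /= => /eqP/e_trans.
(* Among monomials of total degree [d] the exponent of s3 determines the monomial, so this
   coefficient of [I] is the leading coefficient of [p]. *)
move/(congr1 (fun q : {poly k} => q`_(mlead p ord0))); rewrite coef0 coef_sum.
rewrite big_mkcond (bigD1_seq (mlead p)) ?mlead_supp ?msupp_uniq //= eqxx.
rewrite coefZ coefXn eqxx mulr1 big1 ?addr0 => [/eqP|m ml].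
  by rewrite mleadc_eq0 (negPf p0).
case: eqP => // md; rewrite coefZ coefXn; case: eqP => [E0|]; last by rewrite mulr0.
case/eqP: ml; apply/mnmP => i; move: md; rewrite /d !mdeg2 -E0 => /addnI E1.
by case: (unliftP ord0 i) => [i' ->|-> //]; rewrite ord1.
Qed.

End Embedding.

Lemma cubic_form_diagonal (k : fieldType) :
  cubic_form k = diagonal_cubic ((s3 k - s4 k) * s3 k * s4 k)
    (- ((s3 k - 1) * s3 k)) ((s4 k - 1) * s4 k)
    (- ((s3 k - s4 k) * (s3 k - 1) * (s4 k - 1))).
Proof.
rewrite /cubic_form /diagonal_cubic /x1 /x2 /x3 /x4.
set X1 := _ ^+ 3; set X4 := 'X_(inord 3) ^+ 3; set X2 := 'X_(inord 1) ^+ 3.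
set X3 := 'X_(inord 2) ^+ 3; move: (s3 k) (s4 k) => s t.
rewrite -!mul_mpolyC !rmorphE; ring.
Qed.

Section Tower.

Variable k : fieldType.
Variable omega : k.
Hypothesis omega_root : omega ^+ 2 + omega + 1 = 0.

Let omega3 := cube_root_expr3 omega_root.

(** ['X] plays the role of theta; the automorphism is induced by the substitution [omega *: 'X],
    whose third iterate is the identity since omega^3 = 1. *)
Lemma theta_automorphism :
  exists tau : {rmorphism {fraction {poly k}} -> {fraction {poly k}}},
  [/\ forall x, tau (tau (tau x)) = x,
      forall c : k, tau (tofrac c%:P) = tofrac c%:P
    & tau (tofrac 'X) = tofrac omega%:P * tofrac 'X].
Proof.
pose t : {rmorphism {poly k} -> {poly k}} := comp_poly (omega *: 'X).
have tX : t 'X = omega *: 'X by rewrite /t /= comp_polyX.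
have tC c : t c%:P = c%:P by rewrite /t /= comp_polyC.
have tZ c p : t (c *: p) = c *: t p by rewrite /t /= comp_polyZ.
have t3 p : t (t (t p)) = p.
  elim/poly_ind: p => [|p c IH]; first by rewrite !rmorph0.
  rewrite !rmorphD !rmorphM IH !(tX, tC, tZ) !scalerA.
  by rewrite (_ : omega * omega * omega = 1) ?scale1r // -omega3; ring.
have [tau [tauE tau3]] := fraction_automorphism t3.
exists tau; split=> // [c|]; rewrite tauE ?tC // tX.
by rewrite -mul_polyC tofracM.
Qed.

End Tower.

(** Adjoin three independent coordinates to [N], let [tau] act on coefficients, apply
    [rational_diagonal_cubic_norm] there, and descend the resulting norm to [N]. *)
Lemma rational_diagonal_cubic_norm_base (K N : fieldType) (phi : {rmorphism K -> N})
    (tau : {rmorphism N -> N}) (a b c d omega : K) (w v : N) :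
    a != 0 -> b != 0 -> c != 0 -> omega ^+ 2 + omega + 1 = 0 ->
    (forall x, tau (tau (tau x)) = x) -> (forall x, tau (phi x) = phi x) ->
    w ^+ 3 = - phi (d / c) -> tau w = w ->
    v ^+ 3 = - phi (a / b) -> tau v = phi omega * v ->
  rational_surface [:: diagonal_cubic a b c d] ->
  exists y, - phi (b / c) = norm3 tau y.
Proof.
move=> a0 b0 c0 om tau3 tau_phi w3 tau_w v3 tau_v rat.
pose t : {rmorphism {mpoly N[3]} -> {mpoly N[3]}} := map_mpoly tau.
have tC x : t x%:MP = (tau x)%:MP by apply: map_mpolyC.
have t3 p : t (t (t p)) = p.
  have tm q m : (t q)@_m = tau q@_m by apply: mcoeff_map_mpoly.
  by apply/mpolyP => m; rewrite !tm tau3.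
have [g [gE g3]] := fraction_automorphism t3.
pose i0 : {rmorphism N -> {fraction {mpoly N[3]}}} :=
  @tofrac {mpoly N[3]} \o @mpolyC 3 N.
have i0E x : i0 x = tofrac x%:MP by [].
pose iota : {rmorphism K -> {fraction {mpoly N[3]}}} := i0 \o phi.
have iotaE x : iota x = i0 (phi x) by [].
have gi0 x : g (i0 x) = i0 (tau x) by rewrite !i0E gE tC.
pose xi (i : 'I_3) : {fraction {mpoly N[3]}} := tofrac 'X_i.
have xi_free p : mmap iota xi p = 0 -> p = 0.
  have -> : mmap iota xi p = tofrac (map_mpoly phi p).
    by rewrite /map_mpoly rmorph_mmap; apply: eq_mmap.
  move/eqP; rewrite tofrac_eq0 => /eqP E; apply/mpolyP => m.
  apply/eqP; rewrite mcoeff0 -(fmorph_eq0 phi) -mcoeff_map_mpoly E.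
  by rewrite mcoeff0.
have g_iota x : g (iota x) = iota x by rewrite !iotaE gi0 tau_phi.
have g_xi i : g (xi i) = xi i.
  by rewrite /xi gE /t /= map_mpolyX.
have W3 : i0 w ^+ 3 = - iota (d / c) by rewrite -rmorphXn w3 rmorphN.
have V3 : i0 v ^+ 3 = - iota (a / b) by rewrite -rmorphXn v3 rmorphN.
have gW : g (i0 w) = i0 w by rewrite gi0 tau_w.
have gV : g (i0 v) = iota omega * i0 v by rewrite gi0 tau_v rmorphM.
have [x Dx] := rational_diagonal_cubic_norm
  a0 b0 c0 om xi_free g3 g_iota g_xi W3 gW V3 gV rat.
apply: (@norm3_fraction_mpoly 3 N tau g _ x gE).
  by rewrite oppr_eq0 fmorph_eq0 mulf_neq0 ?invr_eq0.
by rewrite -Dx -i0E rmorphN.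
Qed.

(** [W] is the cube root w here, not its cube. Everything follows from s - t = W^3 / E, s - 1 = E t
    and t - 1 = (W^3 - E^2) / (E (E - 1)). *)
Lemma cube_coordinates (N : fieldType) (E W s t : N) :
    E != 0 -> E - 1 != 0 -> W != 0 ->
    W ^+ 3 - 1 != 0 -> W ^+ 3 - E != 0 -> W ^+ 3 - E ^+ 2 != 0 ->
    s = (E - 1)^-1 * (W ^+ 3 - 1) -> t = (E * (E - 1))^-1 * (W ^+ 3 - E) ->
    let a := (s - t) * s * t in let b := - ((s - 1) * s) in
    let c := (t - 1) * t in let d := - ((s - t) * (s - 1) * (t - 1)) in
  [/\ a != 0, b != 0 & c != 0] /\
  [/\ W ^+ 3 = - (d / c), W ^+ 3 / E ^+ 2 = - (a / b)
    & - (b / c) = E ^+ 2 * (W ^+ 3 - 1) / (W ^+ 3 - E ^+ 2)].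
Proof.
move=> E0 E1 W0 W1 W2 W3 Ds Dt.
have s0 : s != 0 by rewrite Ds mulf_neq0 ?invr_eq0.
have t0 : t != 0 by rewrite Dt mulf_neq0 ?invr_eq0 ?mulf_neq0.
have st : s - t = W ^+ 3 / E by rewrite Ds Dt; field; rewrite E0 E1.
have s1 : s - 1 = E * t by rewrite Ds Dt; field; rewrite E0 E1.
have t1 : t - 1 = (W ^+ 3 - E ^+ 2) / (E * (E - 1)) by rewrite Dt; field; rewrite E0 E1.
have t10 : t - 1 != 0 by rewrite t1 mulf_neq0 ?invr_eq0 ?mulf_neq0.
move=> a b c d.
have st0 : s - t != 0 by rewrite st mulf_neq0 ?invr_eq0 ?expf_neq0.
split; first by rewrite /a /b /c oppr_eq0 s1 !mulf_neq0.
rewrite /a /b /c /d; split.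
- have -> : - ((s - t) * (s - 1) * (t - 1)) / ((t - 1) * t) = - ((s - t) * (s - 1) / t).
    by field; rewrite t10 t0.
  by rewrite st s1 opprK; field; rewrite E0 t0.
- by rewrite st s1; field; rewrite oppr_eq0 !mulf_neq0.
- have -> : - (- ((s - 1) * s) / ((t - 1) * t)) = (s - 1) / t * s / (t - 1).
    by field; rewrite t10 t0.
  by rewrite s1 t1 mulfK // Ds; field; rewrite E0 E1 W3.
Qed.

Lemma div_expr3 (F : fieldType) (x : F) : x != 0 -> x / x ^+ 3 = x ^- 2.
Proof. by move=> x0; rewrite (exprS _ 2) invfM mulVKf. Qed.

(** * Contradiction over M(w), with e = theta^3 transcendental over k *)

Section Specialization.

Variables (k M : fieldType) (omega : k) (j : {rmorphism k -> M}).
Variables (tau : {rmorphism M -> M}) (theta : M).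
Hypothesis omega_root : omega ^+ 2 + omega + 1 = 0.
Hypothesis three : 3%:R != 0 :> k.
Hypothesis tau3 : forall x, tau (tau (tau x)) = x.
Hypothesis tau_j : forall x, tau (j x) = j x.
Hypothesis tau_theta : tau theta = j omega * theta.
Let e := theta ^+ 3.
Hypothesis e_trans : forall I : {poly k}, (map_poly j I).[e] = 0 -> I = 0.

Let tau_e : tau e = e.
Proof.
rewrite /e rmorphXn /= tau_theta exprMn -rmorphXn.
by rewrite (cube_root_expr3 omega_root) rmorph1 mul1r.
Qed.

Let eX n : (0 < n)%N -> e ^+ n != 1.
Proof.
move=> n0; apply/eqP => E.
have /e_trans/eqP : (map_poly j ('X^n - 1)).[e] = 0.
  by rewrite rmorphB /= map_polyXn rmorph1 !hornerE E subrr.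
by rewrite -size_poly_eq0 size_XnsubC.
Qed.

Let e0 : e != 0.
Proof.
apply/eqP => E; have /e_trans/eqP : (map_poly j 'X).[e] = 0 by rewrite map_polyX hornerX.
by rewrite polyX_eq0.
Qed.

(** [phi] embeds k(s3, s4) into M(w) by [param]; its image is fixed by [tau] acting on coefficients,
    because [tau] fixes [e]. Rationality would make rho a norm, against [not_norm3_at_one]. *)
Lemma cubic_surface_not_rational_over : ~ rational_surface (cubic_surface k).
Proof.
rewrite /cubic_surface cubic_form_diagonal => rat.
pose f0 : {rmorphism {mpoly k[2]} -> {poly M}} := mmap (polyC \o j) (param e).
have [|phi phiE] := @fraction_extension {mpoly k[2]} _ (@tofrac {poly M} \o f0).
  by move=> p /= /eqP; rewrite tofrac_eq0 => /eqP; apply: param_free.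
pose t : {rmorphism {poly M} -> {poly M}} := map_poly tau.
have t3 p : t (t (t p)) = p.
  have tm q m : (t q)`_m = tau q`_m by apply: coef_map.
  by apply/polyP => m; rewrite !tm tau3.
have [g [gE g3]] := fraction_automorphism t3.
have tf0 p : t (f0 p) = f0 p.
  rewrite rmorph_mmap; apply: eq_mmap => [x|i] /=.
    by rewrite map_polyC /= tau_j.
  rewrite /param; case: ifP => _; rewrite map_polyZ /= fmorphV.
    by rewrite !rmorphB /= map_polyXn !rmorph1 tau_e.
  by rewrite rmorphM !rmorphB /= map_polyXn map_polyC rmorph1 /= tau_e.
have g_phi x : g (phi x) = phi x.
  have [n [m [_ ->]]] := fractionP x.
  by rewrite !fmorph_div !phiE /= !gE !tf0.
pose i1 : {rmorphism M -> {fraction {poly M}}} := @tofrac {poly M} \o polyC.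
have i1E x : i1 x = tofrac x%:P by [].
pose W : {fraction {poly M}} := tofrac 'X.
have gi1 x : g (i1 x) = i1 (tau x) by rewrite !i1E gE /t /= map_polyC.
have gW : g W = W by rewrite /W gE /t /= map_polyX.
have WX c : W ^+ 3 - i1 c != 0.
  rewrite /W i1E -tofracXn -tofracB tofrac_eq0 -size_poly_gt0 size_XnsubC //.
have phiX (i : 'I_2) : phi (tofrac 'X_i) = tofrac (param e i).
  by rewrite phiE /= mmapX mmap1U.
have tofracZ (x : M) (p : {poly M}) : tofrac (x *: p) = i1 x * tofrac p.
  by rewrite -mul_polyC tofracM.
have phi_s : phi (s3 k) = (i1 e - 1)^-1 * (W ^+ 3 - 1).
  rewrite phiX /param eqxx tofracZ fmorphV rmorphB rmorph1.
  by rewrite tofracB tofracXn tofrac1.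
have phi_t : phi (s4 k) = (i1 e * (i1 e - 1))^-1 * (W ^+ 3 - i1 e).
  rewrite phiX /param -val_eqE /= !inordK //= tofracZ fmorphV
     rmorphM rmorphB rmorph1.
  by rewrite tofracB tofracXn.
have E0 : i1 e != 0 by rewrite fmorph_eq0.
have E1 : i1 e - 1 != 0.
  by rewrite -(rmorph1 i1) -rmorphB fmorph_eq0 subr_eq0 -(expr1 e) eX.
have W0 : W != 0 by rewrite tofrac_eq0 polyX_eq0.
have W1 : W ^+ 3 - 1 != 0 by rewrite -(rmorph1 i1) WX.
have W3 : W ^+ 3 - i1 e ^+ 2 != 0 by rewrite -rmorphXn WX.
have /= [[a0 b0 c0] [Dw Dv Dr]] :=
  cube_coordinates E0 E1 W0 W1 (WX e) W3 phi_s phi_t.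
set a := ((s3 k - s4 k) * s3 k * s4 k) in rat.
set b := - ((s3 k - 1) * s3 k) in rat.
set c := ((s4 k - 1) * s4 k) in rat.
set d := - ((s3 k - s4 k) * (s3 k - 1) * (s4 k - 1)) in rat.
have Ea : phi a = (phi (s3 k) - phi (s4 k)) * phi (s3 k) * phi (s4 k).
  by rewrite /a !rmorphM rmorphB.
have Eb : phi b = - ((phi (s3 k) - 1) * phi (s3 k)).
  by rewrite /b rmorphN rmorphM rmorphB rmorph1.
have Ec : phi c = (phi (s4 k) - 1) * phi (s4 k).
  by rewrite /c rmorphM rmorphB rmorph1.
have Ed : phi d =
    - ((phi (s3 k) - phi (s4 k)) * (phi (s3 k) - 1) * (phi (s4 k) - 1)).
  by rewrite /d rmorphN !rmorphM !rmorphB rmorph1.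
rewrite -Ea in a0 Dv; rewrite -Eb in b0 Dv Dr; rewrite -Ec in c0 Dw Dr.
rewrite -Ed in Dw; rewrite !fmorph_eq0 in a0 b0 c0.
rewrite -!fmorph_div in Dw Dv Dr.
pose kK : {rmorphism k -> Kfield k} := @tofrac {mpoly k[2]} \o @mpolyC 2 k.
pose om := kK omega.
have om_root : om ^+ 2 + om + 1 = 0.
  by rewrite -(rmorph1 kK) -rmorphXn -!rmorphD omega_root rmorph0.
have phi_om : phi om = i1 (j omega) by rewrite /om phiE /= mmapC.
pose v := W * i1 theta / i1 e.
have v3 : v ^+ 3 = - phi (a / b).
  have Eth : i1 theta ^+ 3 = i1 e by rewrite -rmorphXn.
  rewrite -Dv /v !exprMn exprVn Eth -i1E -mulrA; congr (_ * _).
  exact: (div_expr3 E0).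
have gv : g v = phi om * v.
  by rewrite /v fmorph_div rmorphM !gi1 gW tau_e tau_theta rmorphM phi_om; ring.
have [y Dy] := rational_diagonal_cubic_norm_base
  a0 b0 c0 om_root g3 g_phi Dw gW v3 gv rat.
have threeM : 3%:R != 0 :> M by rewrite -(rmorph_nat j) fmorph_eq0.
apply: (@not_norm3_at_one M tau e e0 (eX (ltn0Sn 1)) threeM g y gE).
rewrite -Dy Dr tofracZ rmorphXn; congr (_ * _ / _).
  by rewrite tofracB tofracXn tofrac1.
by rewrite tofracB tofracXn -i1E rmorphXn.
Qed.

End Specialization.

Theorem theorem3p6 (k : fieldType)
  (char_neq2 : 2%N \notin [pchar k]) (char_neq3 : 3%N \notin [pchar k])
  (has_root3 : exists w : k, 3.-primitive_root w) :
  ~ rational_surface (cubic_surface k).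
Proof.
have three : 3%:R != 0 :> k by move: char_neq3; rewrite inE.
have [omega prim] := has_root3.
have omega_root : omega ^+ 2 + omega + 1 = 0.
  have omega1 : omega - 1 != 0.
    by rewrite subr_eq0 -[omega]expr1 -(prim_order_dvd prim).
  apply: (mulIf omega1); rewrite mul0r.
  have -> : (omega ^+ 2 + omega + 1) * (omega - 1) = omega ^+ 3 - 1 by ring.
  by rewrite (prim_expr_order prim) subrr.
have [tau [tau3 tauC tauX]] := theta_automorphism omega_root.
pose j : {rmorphism k -> {fraction {poly k}}} := @tofrac {poly k} \o polyC.
apply: (cubic_surface_not_rational_over (j := j) omega_root three tau3 tauC tauX).
(* Transcendence of theta^3: its hypothesis says that [p] composed with ['X^3] is zero, which forces
   [p] to be zero. *)
move=> p; rewrite -tofracXn (map_poly_comp (@tofrac {poly k}) polyC) horner_map /=.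
move/eqP; rewrite tofrac_eq0 => /eqP E; apply/eqP.
by rewrite -(@comp_poly_eq0 _ p 'X^3) ?size_polyXn //; apply/eqP.
Qed.
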